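(* Let $X$ be a Banach space and let $A,B,C,D\in \mathcal{L}(X)$ be such that $$(AC)^2=(DB)(AC),\quad (DB)^2=(AC)(DB),\quad B(AC)A=B(DB)A,\quad C(AC)D=C(DB)D.$$ Then $$\sigma_D(BD)=\sigma_D(AC).$$
   Context: $X$ is a complex Banach space and $\mathcal{L}(X)$ is the Banach algebra of all bounded linear operators from $X$ to itself, with identity $I$. For a ring $R$ and $a\in R$, $comm(a)=\{x\in R : xa=ax\}$ and $comm^2(a)=\{x\in R : xy=yx \text{ for all } y\in comm(a)\}$. An element $a\in R$ is Drazin invertible, written $a\in R^D$, if there exists $b\in R$ such that $b=bab$, $b\in comm^2(a)$ and $a^k=a^{k+1}b$ for some $k\in\mathbb{N}$. For $T\in\mathcal{L}(X)$ the Drazin spectrum is $\sigma_{D}(T)=\{\lambda\in\mathbb{C} : \lambda I-T\notin \mathcal{L}(X)^{D}\}$ (the subscript and superscript $D$ are symbols unrelated to the operator $D$). *)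

(* Defs.v *)
From HB Require Import structures.
From mathcomp Require Import all_boot all_order all_algebra.
From mathcomp Require Import boolp classical_sets functions reals.
From mathcomp Require Import topology normedtype.
From mathcomp Require Export complex.

Set Implicit Arguments.
Unset Strict Implicit.
Unset Printing Implicit Defensive.

Import Order.TTheory GRing.Theory Num.Theory.
Import numFieldNormedType.Exports.

Local Open Scope classical_set_scope.
Local Open Scope ring_scope.

Definition comm (R : pzRingType) (a : R) : set R := [set x | x * a = a * x].

Definition comm2 (R : pzRingType) (a : R) : set R :=
  [set x | forall y, comm a y -> x * y = y * x].

Definition drazin_invertible (R : pzRingType) (a : R) : Prop :=
  exists b : R,
    [/\ b = b * a * b, comm2 a b & exists k : nat, a ^+ k = a ^+ k.+1 * b].

(* The order on [K = R[i]] makes [0 <= M] imply that [M] is real. *)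
Definition operator_bounded (K : numFieldType) (X : normedModType K)
    (f : X -> X) : Prop :=
  exists2 M : K, 0 <= M & forall x, `|f x| <= M * `|x|.

Record bounded_operator (K : numFieldType) (X : normedModType K) :=
  BoundedOperator {
    bop_linear :> {linear X -> X};
    bop_bounded : operator_bounded bop_linear }.

(* [X] may be the zero space, in which case the operators form the zero ring;
   hence the structure below is a [pzRingType] together with an [lmodType],
   and not an [algType], which excludes the zero ring. *)
Section BoundedOperatorRing.
Variables (K : numFieldType) (X : normedModType K).
Implicit Types f g h : bounded_operator X.

HB.instance Definition _ := gen_eqMixin (bounded_operator X).
HB.instance Definition _ := gen_choiceMixin (bounded_operator X).

Lemma bop_ext f g : (forall x, f x = g x) -> f = g.
Proof.
case: f g => [f fb] [g gb] /= fg.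
have {}fg : f = g.
  case: f g fg {fb gb} => [f [[[f0 fD]] [fZ]]] [g [[[g0 gD]] [gZ]]] /= /funext fg.
  move: f0 fD fZ; rewrite {f}fg => f0 fD fZ.
  by rewrite (Prop_irrelevance f0 g0) (Prop_irrelevance fD gD)
             (Prop_irrelevance fZ gZ).
by move: fb; rewrite fg => fb; congr BoundedOperator; exact: Prop_irrelevance.
Qed.

Lemma operator_boundedP (f : {linear X -> X}) :
  operator_bounded f <-> continuous f.
Proof.
rewrite -linear_bounded_continuous linear_boundedP; split.
  move=> [M M0 fM]; near=> r => x; apply: (le_trans (fM x)).
  rewrite ler_wpM2r//; near: r; apply: nbhs_pinfty_ge; exact: ger0_real.
by move=> /pinfty_ex_gt0[M M0 fM]; exists M => //; exact: ltW.
Unshelve. all: by end_near. Qed.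

Lemma operator_bounded0 : operator_bounded (\0 : X -> X).
Proof. by exists 0 => // x; rewrite normr0 mul0r. Qed.

Lemma operator_bounded1 : operator_bounded (@idfun X).
Proof. by exists 1 => // x; rewrite mul1r. Qed.

Lemma operator_boundedN (f : X -> X) :
  operator_bounded f -> operator_bounded (\- f).
Proof. by move=> [M M0 fM]; exists M => // x; rewrite normrN. Qed.

Lemma operator_boundedD (f g : X -> X) :
  operator_bounded f -> operator_bounded g -> operator_bounded (f \+ g).
Proof.
move=> [M M0 fM] [N N0 gN]; exists (M + N); first exact: addr_ge0.
by move=> x; rewrite mulrDl (le_trans (ler_normD _ _))// lerD.
Qed.

Lemma operator_boundedM (f g : X -> X) :
  operator_bounded f -> operator_bounded g -> operator_bounded (f \o g).
Proof.
move=> [M M0 fM] [N N0 gN]; exists (M * N); first exact: mulr_ge0.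
by move=> x; rewrite -mulrA (le_trans (fM _))// ler_wpM2l.
Qed.

Lemma operator_boundedZ (a : K) (f : X -> X) :
  operator_bounded f -> operator_bounded (a \*: f).
Proof.
move=> [M M0 fM]; exists (`|a| * M); first by rewrite mulr_ge0.
by move=> x; rewrite /= normrZ -mulrA ler_wpM2l.
Qed.

Definition bop_zero : bounded_operator X :=
  @BoundedOperator K X (\0 : {linear X -> X}) operator_bounded0.
Definition bop_one : bounded_operator X :=
  @BoundedOperator K X (idfun : {linear X -> X}) operator_bounded1.
Definition bop_opp f : bounded_operator X :=
  @BoundedOperator K X (\- f : {linear X -> X})
    (operator_boundedN (bop_bounded f)).
Definition bop_add f g : bounded_operator X :=
  @BoundedOperator K X (f \+ g : {linear X -> X})
    (operator_boundedD (bop_bounded f) (bop_bounded g)).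
Definition bop_mul f g : bounded_operator X :=
  @BoundedOperator K X (f \o g : {linear X -> X})
    (operator_boundedM (bop_bounded f) (bop_bounded g)).
Definition bop_scale (a : K) f : bounded_operator X :=
  @BoundedOperator K X (a \*: f : {linear X -> X})
    (operator_boundedZ a (bop_bounded f)).

Fact bop_addA : associative bop_add.
Proof. by move=> f g h; apply: bop_ext => x /=; rewrite addrA. Qed.
Fact bop_addC : commutative bop_add.
Proof. by move=> f g; apply: bop_ext => x /=; rewrite addrC. Qed.
Fact bop_add0 : left_id bop_zero bop_add.
Proof. by move=> f; apply: bop_ext => x /=; rewrite add0r. Qed.
Fact bop_addN : left_inverse bop_zero bop_opp bop_add.
Proof. by move=> f; apply: bop_ext => x /=; rewrite addNr. Qed.

HB.instance Definition _ := GRing.isZmodule.Build (bounded_operator X)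
  bop_addA bop_addC bop_add0 bop_addN.

Fact bop_mulA : associative bop_mul.
Proof. by move=> f g h; exact: bop_ext. Qed.
Fact bop_mul1 : left_id bop_one bop_mul.
Proof. by move=> f; exact: bop_ext. Qed.
Fact bop_mulr1 : right_id bop_one bop_mul.
Proof. by move=> f; exact: bop_ext. Qed.
Fact bop_mulDl : left_distributive bop_mul +%R.
Proof. by move=> f g h; exact: bop_ext. Qed.
Fact bop_mulDr : right_distributive bop_mul +%R.
Proof. by move=> f g h; apply: bop_ext => x /=; rewrite linearD. Qed.

HB.instance Definition _ := GRing.Zmodule_isPzRing.Build (bounded_operator X)
  bop_mulA bop_mul1 bop_mulr1 bop_mulDl bop_mulDr.

Fact bop_scaleA a b f : bop_scale a (bop_scale b f) = bop_scale (a * b) f.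
Proof. by apply: bop_ext => x /=; rewrite scalerA. Qed.
Fact bop_scale1 : left_id 1 bop_scale.
Proof. by move=> f; apply: bop_ext => x /=; rewrite scale1r. Qed.
Fact bop_scaleDr : right_distributive bop_scale +%R.
Proof. by move=> a f g; apply: bop_ext => x /=; rewrite scalerDr. Qed.
Fact bop_scaleDl f : {morph bop_scale^~ f : a b / a + b}.
Proof. by move=> a b; apply: bop_ext => x /=; rewrite scalerDl. Qed.

HB.instance Definition _ := GRing.Zmodule_isLmodule.Build K
  (bounded_operator X) bop_scaleA bop_scale1 bop_scaleDr bop_scaleDl.

Lemma bop0E x : (0 : bounded_operator X) x = 0. Proof. by []. Qed.
Lemma bop1E x : (1 : bounded_operator X) x = x. Proof. by []. Qed.
Lemma bopNE f x : (- f) x = - f x. Proof. by []. Qed.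
Lemma bopDE f g x : (f + g) x = f x + g x. Proof. by []. Qed.
Lemma bopME f g x : (f * g) x = f (g x). Proof. by []. Qed.
Lemma bopZE a f x : (a *: f) x = a *: f x. Proof. by []. Qed.

Lemma bop_scalerAl a f g : a *: (f * g) = (a *: f) * g.
Proof. exact: bop_ext. Qed.
Lemma bop_scalerAr a f g : a *: (f * g) = f * (a *: g).
Proof. by apply: bop_ext => x; rewrite !(bopME, bopZE) linearZ. Qed.

End BoundedOperatorRing.

Definition drazin_spectrum (K : numFieldType) (X : normedModType K)
    (T : bounded_operator X) : set K :=
  [set lambda : K |
    ~ drazin_invertible (lambda *: (1 : bounded_operator X) - T)].

(* Main.v *)
Require Import Defs.
From HB Require Import structures.
From mathcomp Require Import all_boot all_order all_algebra.
From mathcomp Require Import boolp classical_sets functions reals.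
From mathcomp Require Import topology normedtype.
From mathcomp Require Import complex.

Import Order.TTheory GRing.Theory Num.Theory.
Import numFieldNormedType.Exports.

Local Open Scope ring_scope.

(** An element [a] is Drazin invertible as soon as [a ^+ n] lies in both
    [a ^+ n.+1 R] and [R a ^+ n.+1] for some [n], so everything reduces to such
    one-sided divisibilities. For a central [c] they pass from [c - b d] to
    [c - d b] because [(c - d b) d = d (c - b d)] (Cline's formula if [c = 0],
    Jacobson's lemma if [c] is a unit). They pass from [c - Q] to [c - P] when
    [P^2 = Q P] and [Q^2 = P Q]: then [(c - P) P = (c - Q) P] and
    [(c - P) Q = (c - Q) Q]. The theorem is the chain
    [BD -> DB = Q -> P = AC] read in both directions. *)

Section Drazin.
Context {R : pzRingType}.
Implicit Types a b c d p q x y z : R.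

Lemma intertwineX {a b z} n : a * z = z * b -> a ^+ n * z = z * b ^+ n.
Proof.
move=> az; elim: n => [|n IHn]; first by rewrite !expr0 mul1r mulr1.
by rewrite exprSr -mulrA az mulrA IHn -mulrA -exprSr.
Qed.

Lemma exprS_mulX {a x n} j :
  a ^+ n = a ^+ n.+1 * x -> a ^+ n = a ^+ (n + j) * x ^+ j.
Proof.
move=> ax; elim: j => [|j IHj]; first by rewrite addn0 expr0 mulr1.
by rewrite IHj addnC exprD ax [x ^+ j.+1]exprS !mulrA -exprD !addnS (addnC j).
Qed.

Lemma mulX_exprS {a y n} j :
  a ^+ n = y * a ^+ n.+1 -> a ^+ n = y ^+ j * a ^+ (n + j).
Proof.
move=> ya; elim: j => [|j IHj]; first by rewrite addn0 expr0 mul1r.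
by rewrite IHj exprD {1}ya [y ^+ j.+1]exprSr -!mulrA -exprD addSnnS.
Qed.

(** With [u = a ^+ n], the relation [y * u = u * x] gives the inverse two forms, [u * x ^+ n.+1] and
    [y ^+ n.+1 * u]; hence [a * b = b * a = e], an idempotent that fixes [u] on both sides. *)
Lemma drazin_invertibleI a n x y :
  a ^+ n = a ^+ n.+1 * x -> a ^+ n = y * a ^+ n.+1 -> drazin_invertible a.
Proof.
move=> ax ya; set u := a ^+ n.
have yu : y * u = u * x by rewrite /u {1}ax mulrA -ya.
pose b := u * x ^+ n.+1; pose e := u * x ^+ n.
have eE : e = y ^+ n * u by rewrite (intertwineX n yu).
have bE : b = y ^+ n.+1 * u by rewrite (intertwineX n.+1 yu).
have abe : a * b = e by rewrite /b /u exprS !mulrA -exprS -ax.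
have bae : b * a = e by rewrite bE /u exprSr -!mulrA -exprSr -ya eE.
have ue : u * e = u by rewrite /e mulrA -exprD -exprS_mulX.
have eu : e * u = u by rewrite eE -mulrA -exprD -mulX_exprS.
have be : b * e = b by rewrite bE -mulrA ue.
have eb : e * b = b by rewrite /b mulrA eu.
exists b; split; first by rewrite bae eb.
- move=> c; rewrite /comm /= => ca.
  (* [e] commutes with [c]: it is both a left and a right multiple of [u], which commutes with [c],
     so [e * c] and [c * e] both equal [e * c * e]. *)
  have uc : u * c = c * u by rewrite (intertwineX n (esym ca)).
  have ec : e * c = e * c * e.
    by rewrite {1}eE -mulrA uc -{1}ue !mulrA -(mulrA _ c u) -uc mulrA -eE.
  have ce : c * e = e * c * e.
    by rewrite {1}/e mulrA -uc -{1}eu -(mulrA e u) uc -!mulrA.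
  rewrite -{1}be -mulrA ec -ce -abe !mulrA -(mulrA b c) ca mulrA bae ec -ce.
  by rewrite -(mulrA c e u) eu -mulrA.
- by exists n; rewrite exprSr -mulrA abe ue.
Qed.

Lemma drazin_invertibleE a : drazin_invertible a ->
  exists n x, [/\ a ^+ n = a ^+ n.+1 * x, a ^+ n = x * a ^+ n.+1 &
                  a * x = x * a].
Proof.
move=> [x [_ xa [n ax]]]; have {}xa := xa a (erefl _).
by exists n, x; split => //; rewrite {1}ax (intertwineX n.+1 (esym xa)).
Qed.

Lemma drazin_invertible_unit a c d n z w : c * d = 1 -> d * c = 1 ->
  a ^+ n * c = a ^+ n.+1 * z -> c * a ^+ n = w * a ^+ n.+1 ->
  drazin_invertible a.
Proof.
move=> cd dc az wa; apply: (@drazin_invertibleI a n (z * d) (d * w)).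
  by rewrite mulrA -az -mulrA cd mulr1.
by rewrite -mulrA -wa mulrA dc mul1r.
Qed.

(** Abstracts the scalars [l *: 1], so that the transfers hold in any ring. *)
Definition central_zero_or_unit c :=
  (forall x, c * x = x * c) /\ (c = 0 \/ exists2 d, c * d = 1 & d * c = 1).

Lemma drazin_invertible_swap c b d : central_zero_or_unit c ->
  drazin_invertible (c - b * d) -> drazin_invertible (c - d * b).
Proof.
move=> [cC c0u] /drazin_invertibleE[n [x [ax xa _]]].
set a := c - b * d in ax xa; pose t := c - d * b.
have td : t * d = d * a by rewrite mulrBl mulrBr cC !mulrA.
have bt : a * b = b * t by rewrite mulrBl mulrBr cC !mulrA.
have tS m : t ^+ m.+1 = t ^+ m * c - d * a ^+ m * b.
  by rewrite exprSr mulrBr mulrA (intertwineX m td).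
have [c0|[c' cc' c'c]] := c0u.
- have tSS m : t ^+ m.+1 = - (d * a ^+ m * b) by rewrite tS c0 mulr0 sub0r.
  (* For the right witness, [d * a ^+ n * b = d * a ^+ n.+2 * x ^+ 2 * b], and [d] carries
     [a ^+ n.+2] to [t ^+ n.+2]; the left one is symmetric, through [b]. *)
  apply: (@drazin_invertibleI t n.+1 (- (d * x ^+ 2 * b)) (- (d * x ^+ 2 * b))).
    rewrite {1}tSS (exprS_mulX 2 ax) addn2 mulrN; congr (- _).
    move: (t ^+ _) (a ^+ _) (x ^+ 2) (intertwineX n.+2 td) => ? ? ? h.
    by rewrite !mulrA h.
  rewrite {1}tSS (mulX_exprS 2 xa) addn2 mulNr; congr (- _).
  move: (t ^+ _) (a ^+ _) (x ^+ 2) (intertwineX n.+2 bt) => ? ? ? h.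
  by rewrite -!mulrA -h !mulrA.
(* Here [t ^+ n * c = t ^+ n.+1 + d * a ^+ n * b], whose last term is [t ^+ n.+1 * d * x * b]. *)
- apply: (@drazin_invertible_unit t c c' n (1 + d * x * b) (1 + d * x * b)) => //.
    rewrite mulrDr mulr1 !mulrA (intertwineX n.+1 td) -(mulrA d) -ax tS.
    by rewrite subrK.
  rewrite mulrDl mul1r -!mulrA -(intertwineX n.+1 bt) (mulrA x) -xa tS cC.
  by rewrite -(mulrA d) subrK.
Qed.

Lemma drazin_invertible_absorb c p q : central_zero_or_unit c ->
  p ^+ 2 = q * p -> q ^+ 2 = p * q ->
  drazin_invertible (c - q) -> drazin_invertible (c - p).
Proof.
rewrite !expr2 => -[cC c0u] pp qq /drazin_invertibleE[n [x [ax xa xC]]].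
set a := c - q in ax xa xC; pose t := c - p.
have pt : t * p = p * t by rewrite mulrBl mulrBr cC.
have ap m : a ^+ m * p = p * t ^+ m.
  by apply: intertwineX; rewrite mulrBl mulrBr cC pp.
have tp m : t ^+ m * p = a ^+ m * p by rewrite (intertwineX m pt) ap.
have tq m : t ^+ m * q = a ^+ m * q.
  have aq : a * q = q * a by rewrite mulrBl mulrBr cC.
  rewrite (intertwineX m aq); apply: intertwineX.
  by rewrite mulrBl mulrBr cC qq.
have xq : q * x = x * q.
  have -> : q = c - a by rewrite opprB addrC subrK.
  by rewrite mulrBl mulrBr cC xC.
have tS m : t ^+ m.+1 = t ^+ m * c - a ^+ m * p.
  by rewrite exprSr mulrBr tp.
have [c0|[c' cc' c'c]] := c0u.
- have tSS m : t ^+ m.+1 = - (a ^+ m * p) by rewrite tS c0 mulr0 sub0r.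
  (* On the right, powers of [a] become powers of [t] only in front of [p] or [q]. The third factor
     [a = - q] split off from [a ^+ (n + 3)] supplies this [q]. *)
  apply: (@drazin_invertibleI t n.+1 (q * x ^+ 3 * p) (- (x ^+ 2 * p))).
    rewrite tSS (exprS_mulX 3 ax) addn3 exprSr /a c0 sub0r mulrN mulNr mulNr.
    by rewrite opprK !mulrA tq /a c0 sub0r.
  by rewrite {1}tSS (mulX_exprS 2 xa) addn2 -mulrA ap mulrA mulNr.
- have wa : c * t ^+ n = (1 + x * p) * t ^+ n.+1.
    by rewrite mulrDl mul1r -mulrA -ap mulrA -xa tS subrK cC.
  (* The unit is [c * c] because [t ^+ n * c] leaves the term [t ^+ n * p]; a second [c] turns it
     into [t ^+ n.+1 * p + t ^+ n * p * p], and [p * p = q * p] provides the [q] needed to reach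
     [t ^+ n.+1]. *)
  apply: (@drazin_invertible_unit t (c * c) (c' * c') n (c + p + q * x * p)
    (c * (1 + x * p))).
  + by rewrite -mulrA (mulrA c c') cc' mul1r.
  + by rewrite -mulrA (mulrA c' c) c'c mul1r.
  + have tpp : t ^+ n * p * p = t ^+ n.+1 * (q * x * p).
      by rewrite tp -mulrA pp mulrA {1}ax -(mulrA _ x q) -xq !mulrA tq.
    have tc : t ^+ n * c = t ^+ n.+1 + t ^+ n * p by rewrite tS tp subrK.
    rewrite !mulrDr -tpp -addrA -mulrDl -tc mulrA [in LHS]tc mulrDl.
    by rewrite -(mulrA _ p c) -(cC p) mulrA.
  + by rewrite -!mulrA wa.
Qed.

End Drazin.

Theorem theorem4p4 (R : realType) (X : completeNormedModType R[i])
    (A B C D : bounded_operator X)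
    (hAC : (A * C) ^+ 2 = (D * B) * (A * C))
    (hDB : (D * B) ^+ 2 = (A * C) * (D * B))
    (hBA : B * (A * C) * A = B * (D * B) * A)
    (hCD : C * (A * C) * D = C * (D * B) * D) :
  drazin_spectrum (B * D) = drazin_spectrum (A * C).
Proof.
have scal0u (l : R[i]) : central_zero_or_unit (l *: (1 : bounded_operator X)).
  split=> [T|]; first by rewrite -bop_scalerAl -bop_scalerAr mul1r mulr1.
  have [->|l0] := eqVneq l 0; [by left; rewrite scale0r | right].
  exists (l^-1 *: (1 : bounded_operator X));
    by rewrite -bop_scalerAl mul1r scalerA ?mulfV ?mulVf// scale1r.
(* By contraposition, the first inclusion carries invertibility from [A * C] through [D * B] to
   [B * D], the second one back. *)
apply/seteqP; split=> l /= nBD nAC; apply: nBD.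
  by apply: drazin_invertible_swap => //; exact: drazin_invertible_absorb nAC.
apply: (@drazin_invertible_absorb _ _ _ (D * B)) => //.
exact: drazin_invertible_swap.
Qed.
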